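(* Let $\Phi=\mathrm{id}$ be the coordinate dictionary, i.e. $\Phi=\{\phi_j\}_{j=1}^d$ with $\phi_j(\mathbf{x})=[\mathbf{x}]_j$ the $j$th coordinate function on $\Omega\subset\mathbb{R}^d$, and assume $\phi_1,\dots,\phi_d$ lie in $L^2(\Omega;\mathbb{R})$ and are linearly independent there. Let $(\Psi_N)_{N\ge1}$ be a sequence of finite dictionaries in $L^2(\Omega;\mathbb{R})$, each consisting of functions linearly independent in $L^2(\Omega;\mathbb{R})$, whose spans become dense in $L^2(\Omega;\mathbb{R})$ in the limit $N\to\infty$. Suppose that for each $N$, writing $\Psi_N=\{\psi_i\}_{i=1}^{N_1}$, the snapshots $\{\mathbf{x}_m\}_{m=1}^M$ and weights $W$ define, as $M\to\infty$, a convergent quadrature rule for the inner products $\langle\psi_i,\psi_j\rangle$, $\langle\phi_i,\phi_j\rangle$ and $\langle\psi_i,\mathcal{K}\phi_j\rangle$ (for all relevant indices). Let $K$ (depending on $N$ and $M$) be the least-squares solution of $$\min_{K\in\mathbb{R}^{N_1\times d}}\big\|\sqrt{W}\,\Psi_N(\mathbf{X})K-\sqrt{W}\,\Phi(\mathbf{Y})\big\|_F^2,$$ and define the predictor $F_{N,M}(\mathbf{x})=K^\top\Psi_N(\mathbf{x})$. Then $$\lim_{N\to\infty}\lim_{M\to\infty}\big\|F-F_{N,M}\big\|_{L^2(\Omega;\mathbb{R}^d)}=0.$$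
   Context: Dynamics: $\Omega\subset\mathbb{R}^d$ and $F:\Omega\to\Omega$ is a (generally nonlinear) map. $L^2(\Omega;\mathbb{R})$ is taken with respect to Lebesgue measure $m$, with real inner product $\langle f,g\rangle=\int_\Omega fg\,dm$; $L^2(\Omega;\mathbb{R}^d)$ is the corresponding space of $\mathbb{R}^d$-valued functions with the Euclidean norm on $\mathbb{R}^d$. The Koopman operator is $\mathcal{K}:L^2(\Omega;\mathbb{R})\to L^2(\Omega;\mathbb{R})$, $\mathcal{K}g=g\circ F$; $F$ is assumed to be such that this is a well-defined bounded linear operator. Data: for each $M$ there are snapshots $\mathbf{x}_1,\dots,\mathbf{x}_M\in\Omega$ and a diagonal matrix $W\in\mathbb{R}^{M\times M}$ with positive diagonal entries $w_1,\dots,w_M$ (points and weights may depend on $M$). Dictionary functions are evaluated pointwise (fixed representatives). For a dictionary $\Psi_N=\{\psi_i\}_{i=1}^{N_1}$ (both $N_1$ and the functions depend on $N$), $\Psi_N(\mathbf{x})=(\psi_1(\mathbf{x}),\dots,\psi_{N_1}(\mathbf{x}))^\top\in\mathbb{R}^{N_1}$, and $\Psi_N(\mathbf{X})\in\mathbb{R}^{M\times N_1}$ is the matrix with entries $\psi_i(\mathbf{x}_m)$. $\Phi(\mathbf{Y})\in\mathbb{R}^{M\times d}$ is the matrix with entries $\phi_j(F(\mathbf{x}_m))=[F(\mathbf{x}_m)]_j$. Convergent quadrature means that for each of the listed inner products $\langle f,g\rangle$ one has $\sum_{m=1}^M w_m f(\mathbf{x}_m)g(\mathbf{x}_m)\to\langle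 f,g\rangle$ as $M\to\infty$, where $(\mathcal{K}\phi_j)(\mathbf{x}_m)=[F(\mathbf{x}_m)]_j$. Standing assumption: for each $N$, $\Psi_N(\mathbf{X})$ has full column rank for all sufficiently large $M$. For such $M$ the least-squares solution is $K=\big(\Psi_N(\mathbf{X})^\top W\Psi_N(\mathbf{X})\big)^{-1}\Psi_N(\mathbf{X})^\top W\,\Phi(\mathbf{Y})$. ''The spans become dense in the limit $N\to\infty$'' means that for every $g\in L^2(\Omega;\mathbb{R})$ the $L^2$-distance from $g$ to $\mathrm{span}\,\Psi_N$ tends to $0$ as $N\to\infty$. *)

(* Defs.v *)
From HB Require Import structures.
From mathcomp Require Import all_boot all_order all_algebra.
From mathcomp Require Import all_classical all_reals all_analysis.

Set Implicit Arguments.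
Unset Strict Implicit.
Unset Printing Implicit Defensive.

Import Order.TTheory GRing.Theory Num.Theory.
Import numFieldNormedType.Exports.

Local Open Scope classical_set_scope.
Local Open Scope ring_scope.

(* Lebesgue measure on R^d, d >= 1, as the Caratheodory restriction of the
   Lebesgue outer measure (infimum of the total volume of the countable covers
   by half-open boxes). Points are column vectors; the positive dimension is
   written d.+1, so that an empty box always has volume 0. *)
Section LebesgueMeasure.
Context {R : realType} {d : nat}.
Local Notation point := 'cV[R]_d.+1.

Definition box (p : point * point) : set point :=
  [set x | forall i, p.1 i 0 < x i 0 <= p.2 i 0].

Definition box_volume (p : point * point) : R :=
  \prod_i (p.2 i 0 - p.1 i 0).

Definition box_cover (A : set point) : set (nat -> point * point) :=
  [set B : nat -> point * point |
    (forall k i, (B k).1 i 0 <= (B k).2 i 0) /\ A `<=` \bigcup_k box (B k)].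

Definition lebesgue_outer (A : set point) : \bar R :=
  ereal_inf [set (\sum_(k <oo) (box_volume (B k))%:E)%E | B in box_cover A].

Lemma box_cover_volume_ge0 A B k : box_cover A B -> (0 <= (box_volume (B k))%:E)%E.
Proof.
by case=> leB _; rewrite lee_fin; apply: prodr_ge0 => i _; rewrite subr_ge0.
Qed.

Lemma lebesgue_outer_ge0 A : (0 <= lebesgue_outer A)%E.
Proof.
apply: le_ereal_inf_tmp => _ [B AB <-]; apply: nneseries_ge0 => k _ _.
exact: box_cover_volume_ge0 AB.
Qed.

Lemma le_lebesgue_outer : {homo lebesgue_outer : A B / A `<=` B >-> (A <= B)%E}.
Proof.
move=> A B AB; apply/ereal_inf_le_tmp => _ [C [leC BC] <-].
by exists C => //; split => //; exact: subset_trans BC.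
Qed.

Lemma lebesgue_outer0 : lebesgue_outer set0 = 0%E.
Proof.
apply/eqP; rewrite eq_le lebesgue_outer_ge0 andbT.
apply: ereal_inf_lbound; exists (fun=> (0, 0)); first by split=> //= k i.
apply: eseries0 => k _ _; congr EFin.
by rewrite /box_volume big_ord_recl subrr mul0r.
Qed.

Lemma lebesgue_outer_sigma_subadditive : sigma_subadditive lebesgue_outer.
Proof.
move=> A; have [[i ioo]|] := pselect (exists i, lebesgue_outer (A i) = +oo%E).
  rewrite (eseries_pinfty _ _ ioo) ?leey// => n _.
  by rewrite -ltNye (lt_le_trans _ (lebesgue_outer_ge0 _)).
rewrite -forallNE => Aoo.
suff add2e (e : {posnum R}) : (lebesgue_outer (\bigcup_n A n) <=
    \sum_(i <oo) lebesgue_outer (A i) + e%:num%:E)%E.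
  by apply/lee_addgt0Pr => _/posnumP[].
rewrite (le_trans _ (epsilon_trick _ _ _))//; last first.
  by move=> n; exact: lebesgue_outer_ge0.
pose P n (B : nat -> point * point) := box_cover (A n) B /\
  (\sum_(k <oo) (box_volume (B k))%:E <=
    lebesgue_outer (A n) + (e%:num / (2 ^ n.+1)%:R)%:E)%E.
have [G PG] : {G : nat -> nat -> point * point & forall n, P n (G n)}.
  apply: (@choice _ _ P) => n; rewrite /P /lebesgue_outer.
  set S := (X in ereal_inf X); move infS : (ereal_inf S) => iS.
  case: iS infS => [r Sr|Soo|Soo].
  - have en1 : 0 < e%:num / (2 ^ n.+1)%:R by [].
    have /(lb_ereal_inf_adherent en1) : ereal_inf S \is a fin_num by rewrite Sr.
    move=> [_ [B AnB <-] muBx].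
    by exists B; split => //; rewrite -Sr; exact/ltW.
  - by have := Aoo n; rewrite /lebesgue_outer Soo.
  - suff : lbound S 0%E by move/le_ereal_inf_tmp; rewrite Soo.
    move=> /= _ [B AnB <-]; apply: nneseries_ge0 => k _ _.
    exact: box_cover_volume_ge0 AnB.
pose vol (x : nat * nat) := (box_volume (G x.1 x.2))%:E.
have vol_ge0 x : (0 <= vol x)%E by exact: box_cover_volume_ge0 (PG x.1).1.
apply: (@le_trans _ _ (\esum_(i in setT) vol i)%E).
  apply: ereal_inf_lbound => /=.
  have /card_esym/ppcard_eqP[f] := card_nat2.
  exists (fun k => G (f k).1 (f k).2).
    split => [k i|]; first exact: (PG (f k).1).1.1.
    move=> t [i _ /((PG i).1.2) [j _ Bijt]].
    by exists (f^-1%FUN (i, j)) => //=; rewrite invK ?inE.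
  by rewrite -[LHS](esum_pred_image vol _ xpredT) ?[fun=> _]set_true// image_eq.
rewrite (_ : esum _ _ = \sum_(i <oo) \sum_(j <oo ) vol (i, j))%E; last first.
  pose J : nat -> set (nat * nat) := fun i => [set (i, j) | j in setT].
  rewrite (_ : setT = \bigcup_k J k); last first.
    by rewrite predeqE => -[a b]; split => // _; exists a => //; exists b.
  rewrite esum_bigcupT /=; last 2 first.
    - apply/trivIsetP => i j _ _ ij.
      rewrite predeqE => -[n m] /=; split => //= -[] [_] _ [<-{n} _].
      by move=> [m' _] [] /esym/eqP; rewrite (negbTE ij).
    - by move=> /= [n m]; exact: vol_ge0.
  rewrite -(image_id [set: nat]) -fun_true esum_pred_image//; last first.
    by move=> n _; exact: esum_ge0.
  apply: eq_eseriesr => /= j _.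
  rewrite -(esum_pred_image vol (pair j) predT)//=; last first.
    by move=> ? ? _ _; exact: (@can_inj _ _ _ snd).
  by congr esum; rewrite predeqE => -[a b]; split; move=> [i _ <-]; exists i.
apply: lee_lim.
- by apply: is_cvg_nneseries => n *; apply: nneseries_ge0 => m *.
- apply: is_cvg_nneseries => n *; apply: adde_ge0 => //.
  exact: lebesgue_outer_ge0.
- by near=> n; apply: lee_sum => i _; exact: (PG i).2.
Unshelve. all: by end_near. Qed.

HB.instance Definition _ := isOuterMeasure.Build R point lebesgue_outer
  lebesgue_outer0 lebesgue_outer_ge0 le_lebesgue_outer
  lebesgue_outer_sigma_subadditive.

End LebesgueMeasure.

(* R^(d.+1) with the sigma-algebra of Lebesgue measurable sets. *)
Notation Rspace R d := (caratheodory_type (@lebesgue_outer R d)).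

Definition lebesgue_Rspace (R : realType) (d : nat) :
  set (Rspace R d) -> \bar R := @lebesgue_outer R d.
Arguments lebesgue_Rspace : clear implicits.

HB.instance Definition _ (R : realType) (d : nat) :=
  isMeasure.Build _ (Rspace R d) R (@lebesgue_Rspace R d)
    (caratheodory_measure0 _) (@caratheodory_measure_ge0 _ _ _)
    (@caratheodory_measure_sigma_additive _ _ _).

(* A function on Omega is represented by a total function, whose values outside
   Omega are irrelevant: [f \_ Omega] is its extension by 0. *)
Section L2.
Context {R : realType} {d : nat}.
Local Notation point := (Rspace R d).
Local Notation m := (lebesgue_Rspace R d).
Implicit Types (Omega : set point) (f g : point -> R) (F : point -> point).

Definition L2 Omega f : Prop := f \_ Omega \in Lfun m 2%:E.

Definition ae_eq_on Omega f g : Prop :=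
  {ae m, forall x, Omega x -> f x = g x}.

Definition L2norm Omega f : \bar R := 'N[m]_2%:E [EFin \o (f \_ Omega)].

Definition L2inner Omega f g : R := \int[m]_(x in Omega) (f x * g x).

Definition euclidean_norm (n : nat) (v : 'cV[R]_n) : R :=
  Num.sqrt (\sum_i v i 0 ^+ 2).

Definition L2norm_vec (n : nat) Omega (f : point -> 'cV[R]_n) : \bar R :=
  L2norm Omega (fun x => euclidean_norm (f x)).

Definition lincomb (n : nat) (psi : 'I_n -> point -> R) (c : 'I_n -> R) :
    point -> R :=
  fun x => \sum_i c i * psi i x.

Definition L2_lin_indep (n : nat) Omega (psi : 'I_n -> point -> R) : Prop :=
  forall c : 'I_n -> R,
    ae_eq_on Omega (lincomb psi c) (fun=> 0) -> forall i, c i = 0.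

Definition L2dist_span (n : nat) Omega (psi : 'I_n -> point -> R) g : \bar R :=
  ereal_inf [set L2norm Omega (g \- lincomb psi c) | c in [set: 'I_n -> R]].

Definition L2_dense_spans Omega (n : nat -> nat)
    (Psi : forall N, 'I_(n N) -> point -> R) : Prop :=
  forall g, L2 Omega g -> L2dist_span Omega (Psi N) g @[N --> \oo] --> 0%E.

Definition koopman F g : point -> R := g \o F.

Definition koopman_bounded_on_L2 Omega F : Prop :=
  [/\ forall g, L2 Omega g -> L2 Omega (koopman F g),
      forall g h, L2 Omega g -> L2 Omega h -> ae_eq_on Omega g h ->
        ae_eq_on Omega (koopman F g) (koopman F h)
    & exists C : R, forall g, L2 Omega g ->
        (L2norm Omega (koopman F g) <= C%:E * L2norm Omega g)%E].

Definition coordinate (j : 'I_d.+1) : point -> R :=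
  fun x => (x : 'cV[R]_d.+1) j 0.

Definition convergent_quadrature Omega (X : forall M, 'I_M -> point)
    (w : forall M, 'I_M -> R) f g : Prop :=
  \sum_(k < M) w M k * f (X M k) * g (X M k) @[M --> \oo] --> L2inner Omega f g.

End L2.

Section LeastSquares.
Context {R : realType}.

Definition frobenius_norm (m n : nat) (A : 'M[R]_(m, n)) : R :=
  Num.sqrt (\sum_i \sum_j A i j ^+ 2).

Definition weight_sqrt (M : nat) (w : 'I_M -> R) : 'M[R]_M :=
  diag_mx (\row_k Num.sqrt (w k)).

Definition data_matrix (T : Type) (M n : nat) (psi : 'I_n -> T -> R)
    (x : 'I_M -> T) : 'M[R]_(M, n) :=
  \matrix_(k, i) psi i (x k).

Definition least_squares_objective (M n p : nat) (w : 'I_M -> R)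
    (A : 'M[R]_(M, n)) (B : 'M[R]_(M, p)) (K : 'M[R]_(n, p)) : R :=
  frobenius_norm (weight_sqrt w *m A *m K - weight_sqrt w *m B) ^+ 2.

Definition is_least_squares_solution (M n p : nat) (w : 'I_M -> R)
    (A : 'M[R]_(M, n)) (B : 'M[R]_(M, p)) (K : 'M[R]_(n, p)) : Prop :=
  forall K' : 'M[R]_(n, p),
    least_squares_objective w A B K <= least_squares_objective w A B K'.

Definition predictor (T : Type) (n p : nat) (psi : 'I_n -> T -> R)
    (K : 'M[R]_(n, p)) : T -> 'cV[R]_p :=
  fun x => K^T *m (\col_i psi i x).

End LeastSquares.

(* Main.v *)
Require Import Defs.
From mathcomp Require Import all_boot all_order all_algebra.
From mathcomp Require Import all_classical all_reals all_analysis.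
From mathcomp Require Import measurable_realfun ring.

Set Implicit Arguments.
Unset Strict Implicit.

Import Order.TTheory GRing.Theory Num.Theory.
Import numFieldNormedType.Exports.

Local Open Scope classical_set_scope.
Local Open Scope ring_scope.

(** Fix a dictionary psi_1, ..., psi_n and a target f in L^2. The best
    approximation of f in the span of the dictionary has the coefficients
    c0 = G^-1 b, where G is the Gram matrix <psi_i, psi_j> and b is the vector
    <psi_i, f>; linear independence makes G invertible ([gram_unitmx]).

    A least-squares solution K_M satisfies the normal equations G_M K_M = B_M
    ([least_squares_normal_equations]). The entries of G_M and B_M are exactly
    the quadrature sums for <psi_i, psi_j> and <psi_i, F_j>, where F_j, the j-th
    component of F, is the Koopman image of the j-th coordinate; they converge
    to the exact inner products. Matrix inversion is continuous at the
    invertible matrix G, so the columns of K_M converge to the coefficients of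
    the L^2 projections of the F_j ([cvg_least_squares]).

    By Pythagoras, the squared error of the approximation with coefficients c
    is the squared error of the projection plus a quadratic form in c0 - c
    ([pythagoras]). Hence, for a fixed N, the error of the predictor converges
    as M grows to the error of the componentwise projections of F
    ([cvg_residual]). The same identity bounds the error of each projection by
    the distance from F_j to the span of Psi_N ([projection_le_dist]).
    There are finitely many components and each F_j is in L^2, so density
    of the spans sends the limit errors to 0. *)

(** * Limits of matrices, taken entrywise *)

Section MatrixLimits.
Context {R : realType}.

Lemma cvg_mulmx_entry m n p (A : nat -> 'M[R]_(m, n)) (B : nat -> 'M[R]_(n, p))
    (A0 : 'M[R]_(m, n)) (B0 : 'M[R]_(n, p)) :
  (forall i j, A k i j @[k --> \oo] --> A0 i j) ->
  (forall i j, B k i j @[k --> \oo] --> B0 i j) ->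
  forall i j, (A k *m B k) i j @[k --> \oo] --> (A0 *m B0) i j.
Proof.
move=> cA cB i j; rewrite mxE; under eq_fun do rewrite mxE.
by apply: cvg_big => [|l _]; [exact: add_continuous|exact: cvgM].
Qed.

Lemma cvg_det_entry n (A : nat -> 'M[R]_n) (A0 : 'M[R]_n) :
  (forall i j, A k i j @[k --> \oo] --> A0 i j) ->
  \det (A k) @[k --> \oo] --> \det A0.
Proof.
move=> cA; apply: cvg_big => [|s _]; first exact: add_continuous.
apply: cvgM; first exact: cvg_cst.
by apply: cvg_big => [|i _]; [exact: mul_continuous|exact: cA].
Qed.

(** Cramer's formula: away from the zeros of the determinant, the entries of the
    inverse are cofactors divided by the determinant, and these are polynomials
    in the entries of the matrix. *)
Lemma cvg_invmx_entry n (A : nat -> 'M[R]_n) (A0 : 'M[R]_n) :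
  A0 \in unitmx -> (forall i j, A k i j @[k --> \oo] --> A0 i j) ->
  (\forall k \near \oo, A k \in unitmx) /\
  forall i j, invmx (A k) i j @[k --> \oo] --> invmx A0 i j.
Proof.
move=> uA0 cA; have cdet := cvg_det_entry cA.
have det0 : \det A0 != 0 by rewrite -unitfE -unitmxE.
have uA : \forall k \near \oo, A k \in unitmx.
  near=> k; rewrite unitmxE unitfE; near: k; exact: cvgr_neq0 cdet det0.
split=> // i j; rewrite /invmx uA0 !mxE.
apply: (@cvg_trans _ ((\det (A k))^-1 * cofactor (A k) j i @[k --> \oo])).
  apply: near_eq_cvg; near=> k; rewrite ifT ?mxE//.
  by near: k.
apply: cvgM; first exact: cvgV.
apply: cvgM; first exact: cvg_cst.
apply: cvg_det_entry => a b; rewrite !mxE; under eq_fun do rewrite !mxE.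
exact: cA.
Unshelve. all: by end_near. Qed.

End MatrixLimits.

(** * Normal equations of a weighted least-squares problem *)

Section LeastSquares.
Context {R : realType}.

Lemma sqr_frobenius_normE m n (X : 'M[R]_(m, n)) :
  frobenius_norm X ^+ 2 = \tr (X^T *m X).
Proof.
rewrite sqr_sqrtr; last by do 2!apply: sumr_ge0 => ? _; exact: sqr_ge0.
rewrite exchange_big; apply: eq_bigr => j _; rewrite mxE.
by apply: eq_bigr => i _; rewrite mxE expr2.
Qed.

Lemma frobenius_norm_eq0 m n (X : 'M[R]_(m, n)) :
  frobenius_norm X ^+ 2 = 0 -> X = 0.
Proof.
rewrite sqr_sqrtr; last by do 2!apply: sumr_ge0 => ? _; exact: sqr_ge0.
move=> /eqP; rewrite pair_big psumr_eq0 => [/allP X0|*]; last exact: sqr_ge0.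
apply/matrixP => i j; rewrite mxE; apply/eqP.
by have := X0 (i, j) (mem_index_enum _); rewrite sqrf_eq0.
Qed.

(** The gradient of the objective vanishes at a minimiser. Derivatives are
    avoided: with g half the gradient at K, the objective along K - t g is a
    quadratic polynomial in t with linear coefficient -2 |g|^2, and it cannot
    stay above its value at t = 0 unless g = 0. *)
Lemma least_squares_normal_equations M n p (w : 'I_M -> R)
    (A : 'M[R]_(M, n)) (B : 'M[R]_(M, p)) (K : 'M[R]_(n, p)) :
  (forall k, 0 < w k) -> is_least_squares_solution w A B K ->
  A^T *m diag_mx (\row_k w k) *m A *m K = A^T *m diag_mx (\row_k w k) *m B.
Proof.
move=> w0 minK; set S := weight_sqrt w; set D := diag_mx _.
have SS : S^T *m S = D.
  rewrite tr_diag_mx mulmx_diag; congr diag_mx; apply/rowP => k.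
  by rewrite !mxE -expr2 sqr_sqrtr// ltW.
(* The residual is kept abstract, so that distributivity rewrites do not
   expand it. *)
have [r rE] : exists r, r = S *m A *m K - S *m B.
  by exists (S *m A *m K - S *m B).
pose g := (S *m A)^T *m r.
suff g0 : g = 0.
  apply/eqP; rewrite -subr_eq0 -SS -g0 /g rE trmx_mul mulmxBr !mulmxA.
  by rewrite eqxx.
pose a := \tr (g^T *m g); pose b := \tr ((S *m A *m g)^T *m (S *m A *m g)).
have step t : 0 <= - (t * a) *+ 2 + t ^+ 2 * b.
  have := minK (K - t *: g); rewrite /least_squares_objective -/S.
  have -> : S *m A *m (K - t *: g) - S *m B = r - t *: (S *m A *m g).
    by rewrite mulmxBr -scalemxAr rE addrAC.
  rewrite -rE !sqr_frobenius_normE.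
  have -> : (r - t *: (S *m A *m g))^T = r^T - t *: (S *m A *m g)^T.
    by rewrite linearB linearZ.
  rewrite mulmxBl !mulmxBr !linearB /= -!scalemxAr -!scalemxAl !mxtraceZ.
  have -> : \tr ((S *m A *m g)^T *m r) = a.
    by rewrite trmx_mul -mulmxA.
  have -> : \tr (r^T *m (S *m A *m g)) = a.
    by rewrite -mxtrace_tr trmx_mul trmxK trmx_mul -mulmxA.
  rewrite -/b => h.
  rewrite -(lerD2l (\tr (r^T *m r))) addr0; apply: le_trans h _.
  by rewrite le_eqVlt; apply/orP; left; apply/eqP; ring.
have ge0 q (X : 'M[R]_(q, p)) : 0 <= \tr (X^T *m X).
  by rewrite -sqr_frobenius_normE sqr_ge0.
have a0 : a = 0.
  (* The step a / (b + 1) makes the quadratic in t negative when a > 0; adding 1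
     to b avoids a division by zero. *)
  have b1 : 0 < b + 1 by rewrite ltr_wpDl// ge0.
  have := step (a / (b + 1)); have : 0 <= a by exact: ge0.
  rewrite le_eqVlt => /orP[/eqP//|a_gt0].
  have -> : - (a / (b + 1) * a) *+ 2 + (a / (b + 1)) ^+ 2 * b =
      - (a ^+ 2 / (b + 1) ^+ 2) * (b + 2) by field; rewrite gt_eqF.
  rewrite mulNr oppr_ge0 leNgt mulr_gt0 ?divr_gt0 ?exprn_gt0//.
  by rewrite ltr_wpDl// ge0.
by apply: frobenius_norm_eq0; rewrite sqr_frobenius_normE.
Qed.

End LeastSquares.

(** * The inner product of L^2 *)

Section L2.
Context {R : realType} {d : nat} (Omega : set (Rspace R d)).
Local Notation point := (Rspace R d).
Local Notation m := (lebesgue_Rspace R d).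
Implicit Types f g h : point -> R.

Local Lemma lee12 : (1 <= 2%:E :> \bar R)%E.
Proof. exact: lee1n. Qed.

Local Lemma mul_patch f g :
  (fun x => f x * g x) \_ Omega = (f \_ Omega) \* (g \_ Omega).
Proof.
by apply/funext => x; rewrite /patch /=; case: ifP => _; rewrite ?mulr0.
Qed.

Lemma L2_integrable_mul f g : L2 Omega f -> L2 Omega g ->
  m.-integrable setT (EFin \o ((fun x => f x * g x) \_ Omega)).
Proof.
move=> Lf Lg; rewrite mul_patch.
by apply: (Lfun1_integrable _ _).1; exact: Lfun2_mul_Lfun1.
Qed.

Lemma L2_comb a f g : L2 Omega f -> L2 Omega g ->
  L2 Omega (fun x => a * f x + g x).
Proof.
move=> Lf Lg.
rewrite /L2 (_ : _ \_ _ = a *: (f \_ Omega) + (g \_ Omega)).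
  by have [_] := Lfun_submod_closed m lee12; exact.
apply/funext => x.
by rewrite /patch !fctE; case: ifP => _ //; rewrite scaler0 add0r.
Qed.

Lemma L2_cst0 : L2 Omega (fun=> 0).
Proof.
have [L0 _] := Lfun_submod_closed m lee12.
by rewrite /L2 (_ : _ \_ _ = 0)//; apply/funext => x; rewrite /patch; case: ifP.
Qed.

Lemma L2_lincomb n (psi : 'I_n -> point -> R) c :
  (forall i, L2 Omega (psi i)) -> L2 Omega (lincomb psi c).
Proof.
move=> Lpsi; rewrite /lincomb; elim: (index_enum _) => [|i s IH].
  by under eq_fun do rewrite big_nil; exact: L2_cst0.
by under eq_fun do rewrite big_cons; exact: L2_comb.
Qed.

Lemma L2_sub f g : L2 Omega f -> L2 Omega g -> L2 Omega (f \- g).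
Proof.
move=> Lf Lg; rewrite (_ : f \- g = fun x => -1 * g x + f x).
  exact: L2_comb.
by apply/funext => x /=; rewrite mulN1r addrC.
Qed.

Lemma L2innerC f g : L2inner Omega f g = L2inner Omega g f.
Proof. by apply: eq_Rintegral => x _; rewrite mulrC. Qed.

Lemma L2inner_comb a f g h : L2 Omega f -> L2 Omega g -> L2 Omega h ->
  L2inner Omega (fun x => a * f x + g x) h =
  a * L2inner Omega f h + L2inner Omega g h.
Proof.
move=> Lf Lg Lh; rewrite /L2inner !(Rintegral_mkcond _ Omega).
have If := L2_integrable_mul Lf Lh; have Ig := L2_integrable_mul Lg Lh.
have IZf : m.-integrable setT
    (EFin \o (fun x => a * ((fun x => f x * h x) \_ Omega) x)).
  by exact: (integrableZl measurableT a If).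
rewrite -RintegralZl// -RintegralD//; apply: eq_Rintegral => x _.
by rewrite /patch; case: ifP => _; rewrite ?mulr0 ?addr0// mulrDl mulrA.
Qed.

Lemma L2inner_lincomb n (psi : 'I_n -> point -> R) c h :
  (forall i, L2 Omega (psi i)) -> L2 Omega h ->
  L2inner Omega (lincomb psi c) h = \sum_i c i * L2inner Omega (psi i) h.
Proof.
move=> Lpsi Lh; rewrite /lincomb.
suff [] : L2 Omega (fun x => \sum_i c i * psi i x) /\
  L2inner Omega (fun x => \sum_i c i * psi i x) h =
  \sum_i c i * L2inner Omega (psi i) h by [].
elim: (index_enum _) => [|i s [Ls IH]].
  under eq_fun do rewrite big_nil; split; first exact: L2_cst0.
  rewrite /L2inner big_nil; under eq_Rintegral do rewrite mul0r.
  by rewrite /Rintegral integral0.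
under eq_fun do rewrite big_cons; split; first exact: L2_comb.
by rewrite L2inner_comb// IH big_cons.
Qed.

Lemma L2inner_ge0 f : 0 <= L2inner Omega f f.
Proof. by apply: Rintegral_ge0 => x _; rewrite -expr2 sqr_ge0. Qed.

(** Covers at once the norm of a scalar function (one summand) and that of a
    vector-valued function, with g its pointwise Euclidean norm. *)
Lemma L2norm_sum_sqr n (r : 'I_n -> point -> R) g :
  (forall i, L2 Omega (r i)) -> (forall x, g x ^+ 2 = \sum_i r i x ^+ 2) ->
  L2norm Omega g = (Num.sqrt (\sum_i L2inner Omega (r i) (r i)))%:E.
Proof.
move=> Lr gr; rewrite /L2norm unlock.
rewrite -powR12_sqrt; last by apply: sumr_ge0 => i _; exact: L2inner_ge0.
rewrite -poweR_EFin; congr (_ `^ _)%E.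
under eq_integral => x _.
  rewrite (_ : (_ `^ _)%E =
    (\sum_i (((fun x => r i x * r i x) \_ Omega) x)%:E)%E); last first.
    rewrite /= powR_mulrn// sumEFin -normrX ger0_norm ?sqr_ge0//.
    congr EFin; rewrite /patch; case: ifP => _; last by rewrite expr0n big1.
    by rewrite gr; apply: eq_bigr => i _; rewrite expr2.
  over.
rewrite integral_sum//; last by move=> i; exact: L2_integrable_mul.
rewrite -sumEFin; apply: eq_bigr => i _.
rewrite /L2inner Rintegral_mkcond /Rintegral fineK//.
by apply: integrable_fin_num => //; exact: L2_integrable_mul.
Qed.

Lemma L2normE f : L2 Omega f ->
  L2norm Omega f = (Num.sqrt (L2inner Omega f f))%:E.
Proof.
move=> Lf; rewrite (@L2norm_sum_sqr 1 (fun=> f))//; first by rewrite big_ord1.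
by move=> x; rewrite big_ord1.
Qed.

Lemma L2inner_eq0 f : L2 Omega f -> L2inner Omega f f = 0 ->
  ae_eq_on Omega f (fun=> 0).
Proof.
move=> Lf f0; have : L2norm Omega f = 0%E by rewrite L2normE// f0 sqrtr0.
move=> /Lnorm_eq0_eq0 h.
have mf : measurable_fun setT (EFin \o (f \_ Omega)).
  apply/measurable_EFinP; move: Lf; rewrite /L2 inE => /andP[+ _].
  by rewrite inE.
have {h mf} [A [mA A0 subA]] := h mf (lte0n 2); exists A; split=> //.
move=> x /= fx; apply: subA => /= gx; apply: fx => Ox.
by have := gx I; rewrite /patch mem_set// => -[].
Qed.

End L2.

(** * Projection onto the span of a finite dictionary *)

Section Projection.
Context {R : realType} {d : nat} (Omega : set (Rspace R d)).
Local Notation point := (Rspace R d).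
Context (n : nat) (psi : 'I_n -> point -> R).
Context (Lpsi : forall i, L2 Omega (psi i)).
Implicit Types (f : point -> R) (c : 'cV[R]_n).

Definition gram : 'M[R]_n := \matrix_(i, j) L2inner Omega (psi i) (psi j).

Definition moments f : 'cV[R]_n := \col_i L2inner Omega (psi i) f.

Definition projection_coef f : 'cV[R]_n := invmx gram *m moments f.

Definition residual f c : point -> R := f \- lincomb psi (fun i => c i 0).

Lemma L2_residual f c : L2 Omega f -> L2 Omega (residual f c).
Proof. by move=> Lf; apply: L2_sub => //; exact: L2_lincomb. Qed.

Lemma L2inner_lincomb_gram c :
  L2inner Omega (lincomb psi (fun i => c i 0)) (lincomb psi (fun i => c i 0)) =
  (c^T *m gram *m c) 0 0.
Proof.
have Lc := L2_lincomb (fun i => c i 0) Lpsi.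
rewrite L2inner_lincomb// -mulmxA mxE; apply: eq_bigr => i _; rewrite mxE.
congr (_ * _); rewrite L2innerC L2inner_lincomb// mxE; apply: eq_bigr => j _.
by rewrite mxE mulrC L2innerC.
Qed.

(** A kernel vector v of the Gram matrix gives v G v^T = 0, which is the squared
    norm of the combination of the dictionary with coefficients v. *)
Lemma gram_unitmx : L2_lin_indep Omega psi -> gram \in unitmx.
Proof.
move=> indep; rewrite unitmxE unitfE; apply/det0P => -[v v0 vG].
case/eqP: v0; apply/rowP => i; rewrite mxE.
suff /indep/(_ i) : ae_eq_on Omega (lincomb psi (fun i => v^T i 0)) (fun=> 0).
  by rewrite mxE.
apply: L2inner_eq0; first exact: L2_lincomb.
by rewrite L2inner_lincomb_gram trmxK vG mul0mx mxE.
Qed.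

Context (gramU : gram \in unitmx).

(** The normal equations G c0 = b say that the residual at c0 is orthogonal to
    the dictionary; the quadratic form of the Gram matrix is the squared norm of
    the difference of the two combinations. *)
Lemma pythagoras f c : L2 Omega f ->
  let c0 := projection_coef f in
  L2inner Omega (residual f c) (residual f c) =
  L2inner Omega (residual f c0) (residual f c0) +
  ((c0 - c)^T *m gram *m (c0 - c)) 0 0.
Proof.
move=> Lf c0; set r := residual f c0.
have Lr : L2 Omega r by exact: L2_residual.
set s := lincomb psi (fun i => (c0 - c) i 0).
have Ls : L2 Omega s by exact: L2_lincomb.
have rs : residual f c = fun x => 1 * r x + s x.
  apply/funext => x; rewrite mul1r /r /s /residual /lincomb /=.
  rewrite -addrA -sumrN -sumrN -big_split; congr (_ + _); apply: eq_bigr => i _.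
  by rewrite /= !mxE; ring.
have orth i : L2inner Omega (psi i) r = 0.
  have rE : r = fun x => -1 * lincomb psi (fun i => c0 i 0) x + f x.
    by apply/funext => x; rewrite mulN1r addrC.
  rewrite L2innerC rE L2inner_comb//; last exact: L2_lincomb.
  rewrite L2inner_lincomb// (L2innerC Omega f).
  have /matrixP/(_ i 0) : gram *m c0 = moments f by rewrite mulKVmx.
  rewrite !mxE => <-; rewrite mulN1r.
  apply/eqP; rewrite addrC subr_eq0; apply/eqP.
  by apply: eq_bigr => j _; rewrite mxE mulrC L2innerC.
have sr : L2inner Omega s r = 0.
  by rewrite L2inner_lincomb// big1// => i _; rewrite orth mulr0.
rewrite -L2inner_lincomb_gram -/s.
have Lc : L2 Omega (residual f c) by exact: L2_residual.
rewrite {1}rs L2inner_comb// mul1r !(L2innerC Omega _ (residual f c)) rs.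
by rewrite !L2inner_comb// !mul1r sr (L2innerC Omega r) sr addr0 add0r.
Qed.

(** The quadratic form in [pythagoras] is a squared norm, hence nonnegative. *)
Lemma projection_le_dist f : L2 Omega f ->
  (L2norm Omega (residual f (projection_coef f)) <=
    L2dist_span Omega psi f)%E.
Proof.
move=> Lf; apply: le_ereal_inf_tmp => _ [c _ <-].
have -> : f \- lincomb psi c = residual f (\col_i c i).
  apply/funext => x; rewrite /residual /lincomb /=; congr (_ - _).
  by apply: eq_bigr => i _; rewrite mxE.
rewrite !L2normE; do ?exact: L2_residual.
rewrite lee_fin ler_wsqrtr// [leRHS]pythagoras// lerDl -L2inner_lincomb_gram.
exact: L2inner_ge0.
Qed.

(** Only the quadratic form in [pythagoras] depends on M, and it is continuous
    in the coefficients with value 0 at c0. *)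
Lemma cvg_residual f (c : nat -> 'cV[R]_n) : L2 Omega f ->
  let c0 := projection_coef f in
  (forall i, c M i 0 @[M --> \oo] --> c0 i 0) ->
  L2inner Omega (residual f (c M)) (residual f (c M)) @[M --> \oo] -->
  L2inner Omega (residual f c0) (residual f c0).
Proof.
move=> Lf c0 cc; under eq_fun do rewrite pythagoras//.
have dc i (j : 'I_1) : (c0 - c M) i j @[M --> \oo] --> (0 : 'cV[R]_n) i j.
  rewrite ord1 mxE; under eq_fun do rewrite mxE [X in _ + X]mxE.
  by rewrite -(subrr (c0 i 0)); apply: cvgB; [exact: cvg_cst|exact: cc].
have quad : ((c0 - c M)^T *m gram *m (c0 - c M)) 0 0 @[M --> \oo] -->
    ((0 : 'cV[R]_n)^T *m gram *m (0 : 'cV[R]_n)) 0 0.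
  apply: cvg_mulmx_entry => // i j.
  apply: cvg_mulmx_entry => a b; last exact: cvg_cst.
  by rewrite mxE; under eq_fun do rewrite mxE; exact: dc.
rewrite mulmx0 mxE in quad.
suff : L2inner Omega (residual f c0) (residual f c0) +
    ((c0 - c M)^T *m gram *m (c0 - c M)) 0 0 @[M --> \oo] -->
  L2inner Omega (residual f c0) (residual f c0) + 0 by rewrite addr0.
by apply: cvgD quad; exact: cvg_cst.
Qed.

End Projection.

(** * Convergence of the least-squares coefficients and of the error *)

Section LeastSquaresLimit.
Context {R : realType} {d : nat} (Omega : set (Rspace R d)).
Local Notation point := (Rspace R d).

(** The two matrices of the normal equations have quadrature sums as entries.
    As their limit is invertible, so are the empirical Gram matrices for large
    M, and the normal equations then determine K. *)
Lemma cvg_least_squares n (psi : 'I_n -> point -> R) p (f : 'I_p -> point -> R)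
    (x : forall M, 'I_M -> point) (w : forall M, 'I_M -> R)
    (K : forall M : nat, 'M[R]_(n, p)) :
  gram Omega psi \in unitmx -> (forall M k, 0 < w M k) ->
  (forall i j, convergent_quadrature Omega x w (psi i) (psi j)) ->
  (forall i j, convergent_quadrature Omega x w (psi i) (f j)) ->
  (\forall M \near \oo, is_least_squares_solution (w M)
     (data_matrix psi (x M)) (data_matrix f (x M)) (K M)) ->
  forall i j, K M i j @[M --> \oo] --> projection_coef Omega psi (f j) i 0.
Proof.
move=> gU w0 cpp cpf lsK.
pose A M : 'M[R]_(M, n) := data_matrix psi (x M).
pose B M : 'M[R]_(M, p) := data_matrix f (x M).
pose D M : 'M[R]_M := diag_mx (\row_k w M k).
have entry q (g : 'I_q -> point -> R) M i j :
    ((A M)^T *m D M *m data_matrix g (x M)) i j =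
    \sum_(k < M) w M k * psi i (x M k) * g j (x M k).
  rewrite mxE; apply: eq_bigr => k _; rewrite mul_mx_diag !mxE.
  by congr (_ * _); rewrite mulrC.
have cG i j : ((A M)^T *m D M *m A M) i j @[M --> \oo] --> gram Omega psi i j.
  by rewrite mxE; under eq_fun do rewrite entry; exact: cpp.
have cb i j : ((A M)^T *m D M *m B M) i j @[M --> \oo] -->
    (\matrix_(i, j) L2inner Omega (psi i) (f j)) i j.
  by rewrite mxE; under eq_fun do rewrite entry; exact: cpf.
have [uG cGV] := cvg_invmx_entry gU cG.
move=> i j.
have -> : projection_coef Omega psi (f j) i 0 =
    (invmx (gram Omega psi) *m \matrix_(i, j) L2inner Omega (psi i) (f j)) i j.
  by rewrite !mxE; apply: eq_bigr => k _; rewrite !mxE.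
apply: (@cvg_trans _ ((invmx ((A M)^T *m D M *m A M) *m
  ((A M)^T *m D M *m B M)) i j @[M --> \oo])); last exact: cvg_mulmx_entry.
apply: near_eq_cvg; near=> M.
rewrite -(@least_squares_normal_equations _ _ _ _ _ _ _ (K M) (w0 M)).
  by rewrite mulKmx//; near: M.
by near: M.
Unshelve. all: by end_near. Qed.

End LeastSquaresLimit.

Theorem corollary2p1 (R : realType) (d : nat)
  (Omega : set (Rspace R d)) (F : Rspace R d -> Rspace R d)
  (n : nat -> nat) (Psi : forall N, 'I_(n N) -> Rspace R d -> R)
  (x : forall M, 'I_M -> Rspace R d) (w : forall M, 'I_M -> R)
  (K : forall N M : nat, 'M[R]_(n N, d.+1)) :
  measurable Omega ->
  (forall y, Omega y -> Omega (F y)) ->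
  koopman_bounded_on_L2 Omega F ->
  (forall M k, Omega (x M k)) ->
  (forall M k, 0 < w M k) ->
  (forall j, L2 Omega (coordinate j)) ->
  L2_lin_indep Omega (@coordinate R d) ->
  (forall N i, L2 Omega (Psi N i)) ->
  (forall N, L2_lin_indep Omega (Psi N)) ->
  L2_dense_spans Omega Psi ->
  (forall N i j, convergent_quadrature Omega x w (Psi N i) (Psi N j)) ->
  (forall i j,
     convergent_quadrature Omega x w (coordinate i) (coordinate j)) ->
  (forall N i j,
     convergent_quadrature Omega x w (Psi N i) (koopman F (coordinate j))) ->
  (forall N, \forall M \near \oo, \rank (data_matrix (Psi N) (x M)) = n N) ->
  (forall N, \forall M \near \oo,
     is_least_squares_solution (w M) (data_matrix (Psi N) (x M))
       (data_matrix (@coordinate R d) (F \o x M)) (K N M)) ->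
  exists l : nat -> R,
    (forall N,
       L2norm_vec Omega
         (fun y => (F y : 'cV[R]_d.+1) - predictor (Psi N) (K N M) y)
         @[M --> \oo] --> (l N)%:E) /\
    l N @[N --> \oo] --> 0.
Proof.
move=> _ _ [LK _ _] _ w0 Lcoord _ LPsi indep dense cpp _ cpf _ lsK.
pose f j := koopman F (@coordinate R d j).
have Lf j : L2 Omega (f j) by exact: LK.
have gU N : gram Omega (Psi N) \in unitmx by exact: gram_unitmx.
pose r N j := residual (Psi N) (f j) (projection_coef Omega (Psi N) (f j)).
exists (fun N => Num.sqrt (\sum_j L2inner Omega (r N j) (r N j))); split.
  move=> N.
  have normE M : L2norm_vec Omega
      (fun y => (F y : 'cV[R]_d.+1) - predictor (Psi N) (K N M) y) =
    (Num.sqrt (\sum_j L2inner Omega (residual (Psi N) (f j) (col j (K N M)))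
                        (residual (Psi N) (f j) (col j (K N M)))))%:E.
    apply: L2norm_sum_sqr => [j|y]; first exact: L2_residual.
    rewrite sqr_sqrtr; last by apply: sumr_ge0 => j _; exact: sqr_ge0.
    apply: eq_bigr => j _; rewrite !mxE; congr ((_ - _) ^+ 2).
    by apply: eq_bigr => i _; rewrite !mxE.
  under eq_fun do rewrite normE.
  apply: cvg_EFin; first by near=> M.
  rewrite /comp /=.
  apply: (@continuous_cvg _ _ _ _ _ _ Num.sqrt); first exact: sqrt_continuous.
  apply: cvg_big => [|j _]; first exact: add_continuous.
  apply: cvg_residual => // i; under eq_fun do rewrite mxE.
  by apply: cvg_least_squares (cpp N) (cpf N) (lsK N) i j.
have Lr N j : L2 Omega (r N j) by exact: L2_residual.
have normr_cvg0 j : L2norm Omega (r N j) @[N --> \oo] --> (0 : R)%:E.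
  apply: (@squeeze_cvge _ _ _ _ (cst 0%E) _
    (fun N => L2dist_span Omega (Psi N) (f j))).
  - by apply: nearW => N; rewrite Lnorm_ge0; exact: projection_le_dist.
  - exact: cvg_cst.
  - exact: dense.
have cr j : Num.sqrt (L2inner Omega (r N j) (r N j)) @[N --> \oo] --> (0 : R).
  suff : fine (L2norm Omega (r N j)) @[N --> \oo] --> (0 : R).
    by under eq_fun do rewrite L2normE//.
  exact: fine_cvg.
have sum_cvg0 : \sum_j L2inner Omega (r N j) (r N j) @[N --> \oo] -->
    \sum_(j < d.+1) (0 : R).
  apply: cvg_big => [|j _]; first exact: add_continuous.
  under eq_fun do rewrite -[L2inner _ _ _]sqr_sqrtr ?L2inner_ge0// expr2.
  by rewrite -(mulr0 0); apply: cvgM.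
rewrite big1// in sum_cvg0.
suff : Num.sqrt (\sum_j L2inner Omega (r N j) (r N j)) @[N --> \oo] -->
  Num.sqrt (0 : R) by rewrite sqrtr0.
by apply: (@continuous_cvg _ _ _ _ _ _ Num.sqrt); first exact: sqrt_continuous.
Unshelve. all: by end_near. Qed.
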